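(* Let $\Omega\subset\mathbb{R}^d$ be a measurable set that $2$-tiles $\mathbb{R}^d$ by translations of the full lattice $\Lambda$ and such that $L^2(\Omega)$ admits a structured Riesz basis of exponentials. Then there exist a full measure subset $J\subseteq I$, $\alpha\in\mathbb{R}^d$ and $\delta>0$ such that $\Lambda_\Omega(J)$ is $(\alpha,\delta)$-separated.
   Context: $\Lambda=M\mathbb{Z}^d\subset\mathbb{R}^d$, $M\in GL_d(\mathbb{R})$, is a full lattice; $I=M([-\frac12,\frac12)^d)$ is its fundamental domain; $H=\{h\in\mathbb{R}^d:\langle h,\lambda\rangle\in\mathbb{Z}\ \text{for all }\lambda\in\Lambda\}$ is its dual lattice. Write $e_a(x)=e^{2\pi i a\cdot x}$ for $a,x\in\mathbb{R}^d$. A measurable set $\Omega\subset\mathbb{R}^d$ $k$-tiles $\mathbb{R}^d$ by translations of $\Lambda$ if $\sum_{\lambda\in\Lambda}\chi_\Omega(\omega-\lambda)=k$ for a.e. $\omega\in\mathbb{R}^d$ (here $k=2$). In this case $\Lambda_\omega=\{\lambda\in\Lambda:\lambda+\omega\in\Omega\}$ has exactly $k$ elements for a.e. $\omega\in I$; for simplicity it is assumed that this holds for every $\omega\in I$. Listing the elements of $\Lambda_\omega$ in lexicographic order of $\mathbb{R}^d$ gives the vector $\vec\lambda(\omega)=(\lambda_1(\omega),\dots,\lambda_k(\omega))\in(\mathbb{R}^d)^k$. For $J\subseteq I$, $\Lambda_\Omega(J)=\{\vec\lambda(\omega):\omega\in J\}$. A full measure subset $J\subseteq I$ is a measurable set with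 $|I\setminus J|=0$. Given $\alpha\in\mathbb{R}^d$ and $\delta>0$, a set $\Gamma\subseteq(\mathbb{R}^d)^k$ is $(\alpha,\delta)$-separated if $|e^{2\pi i\alpha\cdot\gamma_j}-e^{2\pi i\alpha\cdot\gamma_\ell}|\ge\delta$ for every $\vec\gamma=(\gamma_1,\dots,\gamma_k)\in\Gamma$ and all $j\ne\ell$. For a $k$-tiling set $\Omega$, $L^2(\Omega)$ admits a structured Riesz basis of exponentials if there exist $a_1,\dots,a_k\in\mathbb{R}^d$ such that $\{e_{a_j+h}\}_{h\in H,\,1\le j\le k}$ is a Riesz basis of $L^2(\Omega)$, i.e. it is complete in $L^2(\Omega)$ and there are constants $A,B>0$ such that, for all $\{c_{j,h}\}\in\ell^2(\{1,\dots,k\}\times H)$, $A\sum_{j,h}|c_{j,h}|^2\le\|\sum_{j,h}c_{j,h}e_{a_j+h}\|_{L^2(\Omega)}^2\le B\sum_{j,h}|c_{j,h}|^2$. *)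

(* Defs.v *)
From HB Require Import structures.
From mathcomp Require Import all_boot all_order all_algebra.
From mathcomp Require Import finmap.
From mathcomp Require Import all_classical all_reals all_analysis.
From mathcomp Require Import complex.

Set Implicit Arguments.
Unset Strict Implicit.
Unset Printing Implicit Defensive.

Import Order.TTheory GRing.Theory Num.Theory.
Import numFieldNormedType.Exports.
Import Normc.

Local Open Scope classical_set_scope.
Local Open Scope ring_scope.

Section LebesgueMeasure.
Variables (R : realType) (d : nat).

Definition box (p : 'cV[R]_d * 'cV[R]_d) : set 'cV[R]_d :=
  [set x | forall i : 'I_d, p.1 i 0 <= x i 0 < p.2 i 0].

Definition box_volume (p : 'cV[R]_d * 'cV[R]_d) : R :=
  \prod_(i < d) Num.max 0 (p.2 i 0 - p.1 i 0).

Definition lebesgue_outer (A : set 'cV[R]_d) : \bar R :=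
  ereal_inf [set (\esum_(p in C) (box_volume p)%:E)%E |
    C in [set C : set ('cV[R]_d * 'cV[R]_d) |
      countable C /\ A `<=` \bigcup_(p in C) box p]].

Lemma box_volume_ge0 p : 0 <= box_volume p.
Proof. by apply: prodr_ge0 => i _; rewrite le_max lexx. Qed.

Lemma lebesgue_outer_ge0 A : (0 <= lebesgue_outer A)%E.
Proof.
apply: le_ereal_inf_tmp => _ [C _ <-].
by apply: esum_ge0 => p _; rewrite lee_fin box_volume_ge0.
Qed.

Lemma lebesgue_outer0 : lebesgue_outer set0 = 0%E.
Proof.
apply/eqP; rewrite eq_le lebesgue_outer_ge0 andbT.
apply: ereal_inf_lbound; exists set0; last exact: esum_set0.
by split => //; exact: countable0.
Qed.

Lemma le_lebesgue_outer : {homo lebesgue_outer : A B / A `<=` B >-> (A <= B)%E}.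
Proof.
move=> A B AB; apply: ereal_inf_le_tmp => _ [C [cC BC] <-].
by exists C => //; split => //; exact: subset_trans BC.
Qed.

Lemma lebesgue_outer_sigma_subadditive : sigma_subadditive lebesgue_outer.
Proof.
move=> F; have [[i ioo]|] := pselect (exists i, lebesgue_outer (F i) = +oo%E).
  rewrite (eseries_pinfty _ _ ioo) ?leey// => n _.
  by rewrite -ltNye (lt_le_trans _ (lebesgue_outer_ge0 _)).
rewrite -forallNE => Foo.
apply/lee_addgt0Pr => e e0.
apply: (le_trans _ (epsilon_trick _ _ (ltW e0))); last first.
  by move=> n; exact: lebesgue_outer_ge0.
have /choice[G PG] : forall n, exists C, [/\ countable C,
    F n `<=` \bigcup_(p in C) box p &
    (\esum_(p in C) (box_volume p)%:E <=
      lebesgue_outer (F n) + (e / (2 ^ n.+1)%:R)%:E)%E].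
  move=> n.
  have en0 : 0 < e / (2 ^ n.+1)%:R by rewrite divr_gt0// ltr0n expn_gt0.
  have fn : lebesgue_outer (F n) \is a fin_num.
    by rewrite ge0_fin_numE ?lebesgue_outer_ge0// ltey; exact/eqP.
  have [_ [C [cC FC] <-] Ce] := lb_ereal_inf_adherent en0 fn.
  by exists C; split => //; exact: ltW.
pose a p := ((box_volume p)%:E : \bar R).
have a0 p : (0 <= a p)%E by rewrite lee_fin box_volume_ge0.
apply: (@le_trans _ _ (\esum_(p in \bigcup_n G n) a p)%E).
  apply: ereal_inf_lbound; exists (\bigcup_n G n) => //; split.
    by apply: bigcup_countable => // n _; case: (PG n).
  move=> x [n _ Fnx]; have [_ /(_ x Fnx)[p Gp px] _] := PG n.
  by exists p => //; exists n.
rewrite seqDU_bigcup_eq nneseries_sum_bigcup//.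
apply: lee_nneseries => [n _ _|n _]; first exact: esum_ge0.
have [_ _] := PG n; apply: le_trans.
rewrite esum_mkcond [leRHS]esum_mkcond; apply: le_esum => p _.
case: ifPn => [|_]; last by case: ifP => _ //; exact: a0.
by rewrite inE => -[Gp _]; rewrite mem_set.
Qed.

HB.instance Definition _ := isOuterMeasure.Build R 'cV[R]_d lebesgue_outer
  lebesgue_outer0 lebesgue_outer_ge0 le_lebesgue_outer
  lebesgue_outer_sigma_subadditive.

End LebesgueMeasure.

Definition lebesgue_outer_measure (R : realType) (d : nat) :
  {outer_measure set 'cV[R]_d -> \bar R} := @lebesgue_outer R d.

(* R^d with the sigma-algebra of all Lebesgue measurable sets, obtained by
   Caratheodory's criterion; not only the Borel sets. *)
Definition euclid (R : realType) (d : nat) :=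
  caratheodory_type (lebesgue_outer_measure R d).
HB.instance Definition _ (R : realType) (d : nat) :=
  Measurable.on (euclid R d).

Definition lebesgue (R : realType) (d : nat) :
    {measure set (euclid R d) -> \bar R} :=
  (lebesgue_outer_measure R d : set (euclid R d) -> \bar R).

Section ComplexL2.
Variables (R : realType) (d : nat).
Implicit Types (Omega : set 'cV[R]_d) (f : 'cV[R]_d -> R[i]).

Definition L2_sqnorm Omega f : \bar R :=
  (\int[lebesgue R d]_(x in Omega) (normc (f x) ^+ 2)%:E)%E.

Definition in_L2 Omega f : Prop :=
  [/\ measurable_fun (Omega : set (euclid R d)) (fun x => complex.Re (f x)),
      measurable_fun (Omega : set (euclid R d)) (fun x => complex.Im (f x)) &
      (L2_sqnorm Omega f < +oo)%E].

Variable T : choiceType.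
Implicit Types (phi : T -> 'cV[R]_d -> R[i]) (c : T -> R[i]).

Definition partial_comb phi c (X : {fset T}) : 'cV[R]_d -> R[i] :=
  fun x => \sum_(t <- X) c t * phi t x.

Definition complete_in_L2 Omega phi : Prop :=
  forall f, in_L2 Omega f -> forall eps : R, 0 < eps ->
  exists (c : T -> R[i]) (X : {fset T}),
    (L2_sqnorm Omega (fun x => (f x - partial_comb phi c X x)%R) < eps%:E)%E.

Definition l2_sqnorm c : \bar R :=
  (\esum_(t in [set: T]) (normc (c t) ^+ 2)%:E)%E.

(* F is the sum of the (unconditionally convergent) series
   \sum_t c t * phi t in L^2(Omega): the limit of the net of its finite
   partial sums. *)
Definition L2_sum Omega phi c (F : 'cV[R]_d -> R[i]) : Prop :=
  in_L2 Omega F /\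
  forall eps : R, 0 < eps -> exists X0 : {fset T}, forall X : {fset T},
    (X0 `<=` X)%fset ->
    (L2_sqnorm Omega (fun x => (F x - partial_comb phi c X x)%R) < eps%:E)%E.

Definition riesz_basis Omega phi : Prop :=
  complete_in_L2 Omega phi /\
  exists A B : R, [/\ 0 < A, 0 < B & forall c, (l2_sqnorm c < +oo)%E ->
    exists F, L2_sum Omega phi c F /\
      (A%:E * l2_sqnorm c <= L2_sqnorm Omega F <= B%:E * l2_sqnorm c)%E].

End ComplexL2.

Section Lattice.
Variables (R : realType) (d : nat).
Implicit Types (M : 'M[R]_d) (Omega J : set 'cV[R]_d) (a x w : 'cV[R]_d).

Definition dotp (x y : 'cV[R]_d) : R := \sum_(i < d) x i 0 * y i 0.

Definition expo a x : R[i] :=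
  (cos (2 * pi * dotp a x) +i* sin (2 * pi * dotp a x))%C.

Definition lattice M : set 'cV[R]_d :=
  [set M *m map_mx (fun z : int => z%:~R) z | z in [set: 'cV[int]_d]].

Definition fundamental_domain M : set 'cV[R]_d :=
  [set M *m t | t in [set t : 'cV[R]_d | forall i, - 2^-1 <= t i 0 < 2^-1]].

Definition dual_lattice M : set 'cV[R]_d :=
  [set h | forall l, lattice M l -> dotp h l \is a Num.int].

Definition k_tiles (k : nat) M Omega : Prop :=
  {ae lebesgue R d, forall w : 'cV[R]_d,
    (\esum_(l in lattice M) (\1_Omega (w - l)%R : R)%:E = (k%:R : R)%:E)%E}.

Definition lattice_fibre M Omega w : set 'cV[R]_d :=
  [set l | lattice M l /\ Omega (l + w)].

Definition lexle (x y : 'cV[R]_d) : bool :=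
  ([seq x i 0 | i <- enum 'I_d] <= [seq y i 0 | i <- enum 'I_d]
    :> seqlexi R)%O.

(* Meaningful when lattice_fibre M Omega w has exactly k elements. *)
Definition lambda_vec (k : nat) M Omega w : 'I_k -> 'cV[R]_d :=
  fun j => nth 0 (sort lexle (fset_set (lattice_fibre M Omega w))) j.

Definition Lambda_set (k : nat) M Omega J : set ('I_k -> 'cV[R]_d) :=
  [set lambda_vec M Omega w | w in J].

Definition exp_separated (k : nat) (alpha : 'cV[R]_d) (delta : R)
    (Gamma : set ('I_k -> 'cV[R]_d)) : Prop :=
  forall gamma, Gamma gamma -> forall j l : 'I_k, j != l ->
    delta <= normc (expo alpha (gamma j) - expo alpha (gamma l)).

Definition structured_riesz_basis (k : nat) M Omega : Prop :=
  exists a : 'I_k -> 'cV[R]_d,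
    riesz_basis Omega
      (fun p : 'I_k * dual_lattice M => expo (a p.1 + val p.2)).

Definition full_measure_subset (J I : set 'cV[R]_d) : Prop :=
  [/\ J `<=` I, measurable (J : set (euclid R d)) &
      lebesgue R d (I `\` J) = 0%E].

End Lattice.

Arguments lambda_vec {R d} k M Omega w j.
Arguments Lambda_set {R d} k M Omega J _.

(* Main.v *)
Require Import Defs.
From mathcomp Require Import all_boot all_order all_algebra.
From mathcomp Require Import finmap.
From mathcomp Require Import all_classical all_reals all_analysis.
From mathcomp Require Import measurable_realfun complex.
From mathcomp Require Import ring lra zify.

(** The witness is [alpha = a_0 - a_1], the difference of the two frequency
shifts of the Riesz basis.  For lattice points [l != l'], let [overlap l l']
be the set of the [w] in the fundamental domain [I] with [l + w] and [l' + w]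
in [Omega].  The lattice is countable, so it is enough to find one [delta > 0]
such that [overlap l l'] is null as soon as
[|e_alpha(l) - e_alpha(l')| < delta]: the set [J] is [I] minus these countably
many null sets ([overlap_null]).

Translate the overlap to [E = overlap l l' + l] and put [t = l' - l], so that
[E] and [E + t] both lie in [Omega], and they are disjoint because [I] contains
one point of each coset.  Let [P] be a finite combination of the basis and
[P_0] the part of it with frequencies in [a_0 + H].  A translation by the
lattice vector [t] multiplies each [e_(a_j+h)] by [e_(a_j)(t)], and hence
  [P(x) - e_(-a_1)(t) P(x+t) = (1 - e_alpha(t)) P_0(x)]
([partial_comb_shift]).  Completeness makes [P] as close as desired to the
indicator function of [E] in [L^2(Omega)], and then the left hand side is close
to 1 on [E]; but the right hand side is at most [delta |P_0|].  The two
inequalities of a Riesz basis bound the norm of [P_0] by a constant times that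
of [P] ([riesz_basis_projection_bounded]), hence by a constant times the norm
of the indicator function.  For small [delta] this forces [|E| = 0]
([null_overlap]).

All functions involved are finite combinations of exponentials and indicator
functions on [Omega], and the only facts about Lebesgue measure behind the
estimates are that coordinate half-spaces are Caratheodory measurable and that
translations preserve measure. *)

Set Implicit Arguments.
Unset Strict Implicit.
Unset Printing Implicit Defensive.

Import Order.TTheory GRing.Theory Num.Theory.
Import numFieldNormedType.Exports.
Import Normc.

Local Open Scope classical_set_scope.
Local Open Scope ring_scope.

(** * Lebesgue measure: translations and half-spaces *)

(** Summing over an image counts each value once, so [g] need not be injective:
    a section of [g] embeds the image into [C]. *)
Lemma esum_image_le (R : realType) (T T' : choiceType) (C : set T) (g : T -> T')
    (v : T' -> \bar R) : (forall q, 0 <= v q)%E ->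
  (\esum_(q in g @` C) v q <= \esum_(p in C) v (g p))%E.
Proof.
move=> v0.
have /choice[h hP] : forall q, exists p : option T, (g @` C) q ->
    exists2 p', p = Some p' & C p' /\ g p' = q.
  move=> q; have [[p Cp pq]|nq] := pselect ((g @` C) q).
    by exists (Some p) => _; exists p.
  by exists None => /nq.
pose w (o : option T) : \bar R := if o is Some p then v (g p) else 0%E.
have hinj : set_inj (g @` C) h.
  move=> q q' /[!inE] /hP[p -> [_ <-]] /hP[p' -> [_ <-]].
  by move=> -[->].
have -> : (\esum_(q in g @` C) v q = \esum_(q in g @` C) w (h q))%E.
  by apply: eq_esum => q /hP[p -> [_ <-]].
rewrite -(esum_image (g @` C) h w)//.
have -> : (\esum_(p in C) v (g p) = \esum_(o in Some @` C) w o)%E.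
  by rewrite esum_image// => x y _ _ [].
rewrite esum_mkcond [leRHS]esum_mkcond; apply: le_esum => o _.
case: ifPn => [/[!inE] -[q Cq <-{o}]|_]; last by case: ifP => _ //; case: o => /=.
by have [p -> [Cp _]] := hP _ Cq; rewrite mem_set//; exists p.
Qed.

Section lebesgue_geometry.
Variables (R : realType) (d : nat).
Implicit Types (A : set 'cV[R]_d) (v x : 'cV[R]_d).

(** The outer measure is an infimum over sets of boxes, whereas a cover obtained
    by transforming the boxes of another one is a family in which boxes may
    coincide. *)
Lemma lebesgue_outer_image_cover (C : set ('cV[R]_d * 'cV[R]_d))
    (g : 'cV[R]_d * 'cV[R]_d -> 'cV[R]_d * 'cV[R]_d) A :
  countable C -> A `<=` \bigcup_(p in C) box (g p) ->
  (lebesgue_outer A <= \esum_(p in C) (box_volume (g p))%:E)%E.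
Proof.
move=> cC AC.
apply: (@le_trans _ _ (\esum_(q in g @` C) (box_volume q)%:E)%E).
  apply: ereal_inf_lbound; exists (g @` C) => //; split.
    by apply: (sub_countable _ cC); exact: card_image_le.
  by rewrite bigcup_image.
by apply: esum_image_le => q; rewrite lee_fin box_volume_ge0.
Qed.

Lemma lebesgue_outer_shift_le A v :
  (lebesgue_outer ((fun x => (x + v)%R) @^-1` A) <= lebesgue_outer A)%E.
Proof.
apply: le_ereal_inf_tmp => _ [C [cC AC] <-].
pose g (p : 'cV[R]_d * 'cV[R]_d) := (p.1 - v, p.2 - v).
have vg p : box_volume (g p) = box_volume p.
  by apply: eq_bigr => i _; rewrite /= !mxE; congr Num.max; ring.
under eq_esum => p _ do rewrite -vg.
apply: lebesgue_outer_image_cover => // x /AC[p Cp px]; exists p => // i.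
by move: (px i); rewrite /= !mxE lerBlDr ltrBrDr.
Qed.

Lemma lebesgue_outer_shift A v :
  lebesgue_outer ((fun x => x + v) @^-1` A) = lebesgue_outer A.
Proof.
apply/eqP; rewrite eq_le lebesgue_outer_shift_le/=.
have := lebesgue_outer_shift_le ((fun x => x + v) @^-1` A) (- v).
rewrite -comp_preimage (_ : _ \o _ = id)//.
by apply/funext => x /=; rewrite subrK.
Qed.

(** Exposes the Caratheodory criterion behind the sigma-algebra of [euclid]. *)
Lemma euclid_measurableE A : measurable (A : set (euclid R d)) =
  (lebesgue_outer_measure R d).-caratheodory A.
Proof. by []. Qed.

Lemma measurable_shift v A : measurable (A : set (euclid R d)) ->
  measurable ((fun x => x + v) @^-1` A : set (euclid R d)).
Proof.
rewrite !euclid_measurableE => mA X /=.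
have e (B : set 'cV[R]_d) : lebesgue_outer B =
    lebesgue_outer ((fun x => x - v)%R @^-1` B) by rewrite lebesgue_outer_shift.
(* Testing the translate of A on X amounts to testing A on Y. *)
pose Y : set 'cV[R]_d := (fun x => (x - v)%R) @^-1` X.
have -> : lebesgue_outer X = lebesgue_outer Y by exact: e.
have -> : lebesgue_outer (X `&` (fun x => (x + v)%R) @^-1` A) =
    lebesgue_outer (Y `&` A).
  rewrite e; congr lebesgue_outer.
  by apply/seteqP; split => x; rewrite /Y /preimage /= subrK.
have -> : lebesgue_outer (X `&` ~` ((fun x => (x + v)%R) @^-1` A)) =
    lebesgue_outer (Y `&` ~` A).
  rewrite e; congr lebesgue_outer.
  by apply/seteqP; split => x; rewrite /Y /preimage /= subrK.
exact: mA.
Qed.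

Lemma lebesgue_shift v A : lebesgue R d ((fun x => x + v) @^-1` A) = lebesgue R d A.
Proof. exact: lebesgue_outer_shift. Qed.

(** Each box of a cover is cut by the hyperplane into two boxes whose volumes
    add up to its own, which is the Caratheodory criterion. *)
Lemma measurable_halfspace (i : 'I_d) (c : R) :
  measurable ([set x | x i 0 < c] : set (euclid R d)).
Proof.
apply: (@le_caratheodory_measurable R _ (lebesgue_outer_measure R d)) => X.
rewrite /=; apply: le_ereal_inf_tmp => _ [C [cC XC] <-].
pose lo (p : 'cV[R]_d * 'cV[R]_d) : 'cV[R]_d * 'cV[R]_d :=
  (p.1, \col_j (if j == i then Num.min (p.2 j 0) c else p.2 j 0)).
pose hi (p : 'cV[R]_d * 'cV[R]_d) : 'cV[R]_d * 'cV[R]_d :=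
  (\col_j (if j == i then Num.max (p.1 j 0) c else p.1 j 0), p.2).
have vol p : box_volume p = box_volume (lo p) + box_volume (hi p).
  rewrite /box_volume (bigD1 i)//= [in X in _ = X + _](bigD1 i)//=.
  rewrite [in X in _ = _ + X](bigD1 i)//= !mxE eqxx.
  set P := \prod_(j | j != i) Num.max 0 (p.2 j 0 - p.1 j 0).
  rewrite (_ : \prod_(_ < _ | _) _ = P); last first.
    by apply: eq_bigr => j /negPf ji; rewrite !mxE ji.
  rewrite (_ : \prod_(_ < _ | _) Num.max 0 (p.2 _ _ - (hi p).1 _ _) = P); last first.
    by apply: eq_bigr => j /negPf ji; rewrite !mxE ji.
  rewrite -mulrDl; congr (_ * _).
  set a := p.1 i 0; set b := p.2 i 0.
  rewrite /Num.max /Num.min.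
  by case: (ltP b c) => ?; case: (ltP a c) => ?; do !(case: ltP => ?); lra.
under eq_esum => p _ do rewrite vol EFinD.
rewrite esumD; try by move=> p _; rewrite lee_fin box_volume_ge0.
apply: leeD; apply: lebesgue_outer_image_cover => // x [/XC[p Cp px] xc];
  exists p => // j; have := px j; rewrite !mxE; case: eqP => // ->.
  by rewrite /= lt_min xc andbT.
by move: xc => /= /negP; rewrite -leNgt ge_max => -> /andP[-> ->].
Qed.

Lemma measurable_coord (i : 'I_d) :
  measurable_fun [set: euclid R d] (fun x : euclid R d => (x : 'cV[R]_d) i 0).
Proof.
apply: (measurability (@RGenInftyO.G R)); first exact: RGenInftyO.measurableE.
move=> _ [_ [c ->] <-]; rewrite setTI.
rewrite (_ : _ @^-1` _ = [set x : 'cV[R]_d | x i 0 < c]).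
  exact: measurable_halfspace.
by apply/seteqP; split=> x /=; rewrite in_itv.
Qed.

Lemma lebesgue_box p : (lebesgue R d (box p) <= (box_volume p)%:E)%E.
Proof.
apply: ereal_inf_lbound; exists [set p].
  by split; [exact: countable1|rewrite bigcup_set1].
by rewrite esum_set1// lee_fin box_volume_ge0.
Qed.

End lebesgue_geometry.

(** * Complex functions and their square norm *)

Section complex_measurability.
Variables (R : realType) (d : nat).
Implicit Types (D Omega : set 'cV[R]_d) (f g : 'cV[R]_d -> R[i]).

Definition measurable_complex D f :=
  measurable_fun (D : set (euclid R d)) (fun x => complex.Re (f x)) /\
  measurable_fun (D : set (euclid R d)) (fun x => complex.Im (f x)).

Lemma sqr_normc_ReIm (z : R[i]) :
  normc z ^+ 2 = complex.Re z ^+ 2 + complex.Im z ^+ 2.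
Proof. by case: z => a b; rewrite /normc sqr_sqrtr// addr_ge0// sqr_ge0. Qed.

Lemma normc_ge0 (z : R[i]) : 0 <= normc z.
Proof. by case: z => a b; exact: sqrtr_ge0. Qed.

Lemma normc_triangle (z w : R[i]) : normc (z + w) <= normc z + normc w.
Proof. exact: le_normcD. Qed.

Lemma measurable_complexD D f g : measurable_complex D f ->
  measurable_complex D g -> measurable_complex D (fun x => f x + g x).
Proof.
move=> [f1 f2] [g1 g2]; split.
  rewrite (_ : (fun _ => _) = (fun x => complex.Re (f x)) \+ (fun x => complex.Re (g x))).
    exact: measurable_funD.
  by apply/funext => x /=; case: (f x) (g x) => ? ? [].
rewrite (_ : (fun _ => _) = (fun x => complex.Im (f x)) \+ (fun x => complex.Im (g x))).
  exact: measurable_funD.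
by apply/funext => x /=; case: (f x) (g x) => ? ? [].
Qed.

Lemma measurable_complexZ D (z : R[i]) f : measurable_complex D f ->
  measurable_complex D (fun x => z * f x).
Proof.
case: z => a b [f1 f2]; split.
  rewrite (_ : (fun _ => _) =
      (cst a \* (fun x => complex.Re (f x))) \- (cst b \* (fun x => complex.Im (f x)))).
    by apply: measurable_funB; exact: measurable_funM.
  by apply/funext => x /=; case: (f x).
rewrite (_ : (fun _ => _) =
    (cst a \* (fun x => complex.Im (f x))) \+ (cst b \* (fun x => complex.Re (f x)))).
  by apply: measurable_funD; exact: measurable_funM.
by apply/funext => x /=; case: (f x).
Qed.

Lemma measurable_complexB D f g : measurable_complex D f ->
  measurable_complex D g -> measurable_complex D (fun x => f x - g x).
Proof.
move=> mf /(@measurable_complexZ _ (-1)) mg.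
under eq_fun => x do rewrite -mulN1r.
exact: measurable_complexD.
Qed.

Lemma measurable_partial_comb (T : choiceType) (phi : T -> 'cV[R]_d -> R[i])
    (c : T -> R[i]) (X : {fset T}) D :
  (forall t, measurable_complex D (phi t)) ->
  measurable_complex D (partial_comb phi c X).
Proof.
move=> mphi; rewrite /partial_comb; elim: (enum_fset X) => [|t s ih].
  by under eq_fun do rewrite big_nil; split; exact: measurable_cst.
under eq_fun do rewrite big_cons.
exact: (measurable_complexD (measurable_complexZ (c t) (mphi t)) ih).
Qed.

Lemma measurable_expo (a : 'cV[R]_d) D : measurable_complex D (expo a).
Proof.
have ma : measurable_fun [set: euclid R d] (fun x => 2 * pi * dotp a x).
  apply: (measurable_funM (measurable_cst (2 * pi))).
  apply: measurable_sum => i.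
  exact: (measurable_funM (measurable_cst (a i 0)) (measurable_coord i)).
suff [m1 m2] : measurable_complex setT (expo a).
  by split; apply: measurable_funTS.
split => /=.
  apply: measurableT_comp ma; apply: continuous_measurable_fun.
  exact: continuous_cos.
apply: measurableT_comp ma; apply: continuous_measurable_fun.
exact: continuous_sin.
Qed.

Lemma measurable_sqr_normc D f : measurable_complex D f ->
  measurable_fun (D : set (euclid R d)) (fun x => (normc (f x) ^+ 2)%:E).
Proof.
move=> [f1 f2]; apply/measurable_EFinP.
under eq_fun => x do rewrite sqr_normc_ReIm.
by apply: measurable_funD; exact: measurable_funX.
Qed.

Lemma L2_sqnorm_ge0 D f : (0 <= L2_sqnorm D f)%E.
Proof. by apply: integral_ge0 => x _; rewrite lee_fin sqr_ge0. Qed.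

Lemma L2_sqnorm_subset D D' f :
  measurable (D : set (euclid R d)) -> measurable (D' : set (euclid R d)) ->
  D' `<=` D -> measurable_complex D f -> (L2_sqnorm D' f <= L2_sqnorm D f)%E.
Proof.
move=> mD mD' D'D mf; apply: ge0_subset_integral => //.
  exact: measurable_sqr_normc.
by move=> x _; rewrite lee_fin sqr_ge0.
Qed.

Lemma L2_sqnormD_le D f g : measurable (D : set (euclid R d)) ->
  measurable_complex D f -> measurable_complex D g ->
  (L2_sqnorm D (fun x => (f x + g x)%R) <=
   2%:E * (L2_sqnorm D f + L2_sqnorm D g))%E.
Proof.
move=> mD mf mg.
have nn (h : 'cV[R]_d -> R[i]) x : (0 <= (normc (h x) ^+ 2)%:E)%E.
  by rewrite lee_fin sqr_ge0.
rewrite /L2_sqnorm -ge0_integralD//; try exact: measurable_sqr_normc.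
have mfg : measurable_fun (D : set (euclid R d))
    (fun x => ((normc (f x) ^+ 2)%:E + (normc (g x) ^+ 2)%:E)%E).
  by apply: emeasurable_funD; exact: measurable_sqr_normc.
rewrite -ge0_integralZl_EFin//; last by move=> x _; exact: adde_ge0.
apply: ge0_le_integral; first exact: mD.
- by move=> x _; exact: (nn (fun x => f x + g x)).
- exact: (measurable_sqr_normc (measurable_complexD mf mg)).
- exact: measurable_funeM.
- move=> x _; rewrite -EFinD -EFinM lee_fin.
  set a := normc (f x); set b := normc (g x).
  have s0 : 0 <= normc (f x + g x) := normc_ge0 _.
  have sab : normc (f x + g x) <= a + b := normc_triangle _ _.
  apply: (@le_trans _ _ ((a + b) ^+ 2)); first by rewrite !expr2 ler_pM.
  by have := sqr_ge0 (a - b); lra.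
Qed.

Lemma L2_sqnormZ D (z : R[i]) f : measurable (D : set (euclid R d)) ->
  measurable_complex D f ->
  L2_sqnorm D (fun x => z * f x) = ((normc z ^+ 2)%:E * L2_sqnorm D f)%E.
Proof.
move=> mD mf; rewrite /L2_sqnorm -ge0_integralZl_EFin ?sqr_ge0//.
- by apply: eq_integral => x _; rewrite normcM exprMn EFinM.
- by move=> x _; rewrite lee_fin sqr_ge0.
- exact: measurable_sqr_normc.
Qed.

Lemma L2_sqnormB_le D f g : measurable (D : set (euclid R d)) ->
  measurable_complex D f -> measurable_complex D g ->
  (L2_sqnorm D (fun x => (f x - g x)%R) <=
   2%:E * (L2_sqnorm D f + L2_sqnorm D g))%E.
Proof.
move=> mD mf mg; under eq_fun do rewrite -mulN1r.
have := L2_sqnormD_le mD mf (measurable_complexZ (-1) mg).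
by rewrite L2_sqnormZ// normcN normc1 expr1n mul1e.
Qed.

Lemma measurable_complex_shift D f v : measurable_complex setT f ->
  measurable_complex D (fun x => f (x + v)).
Proof.
move=> [f1 f2].
have mv : measurable_fun [set: euclid R d]
    (fun x : euclid R d => (x : 'cV[R]_d) + v : euclid R d).
  by move=> _ B mB; rewrite setTI; exact: measurable_shift.
split; apply: measurable_funTS; first exact: (measurableT_comp f1 mv).
exact: (measurableT_comp f2 mv).
Qed.

Lemma L2_sqnorm_shift D f v : measurable (D : set (euclid R d)) ->
  measurable_complex setT f ->
  L2_sqnorm D (fun x => f (x + v)) = L2_sqnorm ((fun x => x - v) @^-1` D) f.
Proof.
move=> mD mf; rewrite /L2_sqnorm.
pose phi : euclid R d -> euclid R d := fun x : 'cV[R]_d => x + v.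
pose D' : set (euclid R d) := (fun x : 'cV[R]_d => x - v) @^-1` D.
have mphi : measurable_fun setT phi.
  by move=> _ B mB; rewrite setTI; exact: measurable_shift.
have mD' : measurable D' by exact: (@measurable_shift _ _ (- v)).
have DE : D = phi @^-1` D' by apply/seteqP; split => x; rewrite /phi /D' /= addrK.
transitivity (\int[pushforward (lebesgue R d) phi]_(x in D') (normc (f x) ^+ 2)%:E)%E.
  rewrite (ge0_integral_pushforward mphi)//.
  - by rewrite -DE.
  - by apply: measurable_funTS; exact: measurable_sqr_normc.
  - by move=> x _; rewrite lee_fin sqr_ge0.
by apply: eq_measure_integral => B mB _; exact: lebesgue_shift.
Qed.

End complex_measurability.

(** * Finite combinations of a Riesz basis *)

Section finite_combinations.
Variables (R : realType) (d : nat) (T : choiceType).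
Variables (Omega : set 'cV[R]_d) (phi : T -> 'cV[R]_d -> R[i]).
Implicit Types (c : T -> R[i]) (X : {fset T}).
Hypothesis mOmega : measurable (Omega : set (euclid R d)).
Hypothesis mphi : forall t, measurable_complex Omega (phi t).

Definition restrict_coef (S : T -> bool) c : T -> R[i] :=
  fun t => if S t then c t else 0.

Lemma partial_comb_supp c X Y : (X `<=` Y)%fset ->
  (forall t, t \notin X -> c t = 0) -> partial_comb phi c Y = partial_comb phi c X.
Proof.
move=> XY c0; apply/funext => x; rewrite /partial_comb.
rewrite (big_fset_incl _ XY)// => t _ tX.
by rewrite c0// mul0r.
Qed.

Lemma l2_sqnorm_fin_supp c X : (forall t, t \notin X -> c t = 0) ->
  (l2_sqnorm c < +oo)%E.
Proof.
move=> c0.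
rewrite (_ : l2_sqnorm c = \esum_(t in [set` X]) (normc (c t) ^+ 2)%:E)%E.
  rewrite esum_fset//; last by move=> t _; rewrite lee_fin sqr_ge0.
  by rewrite fsbig_finite//= sumEFin ltry.
rewrite /l2_sqnorm [RHS]esum_mkcond; apply: eq_esum => t _.
case: ifPn => // /negP tX; rewrite c0 ?normc0 ?expr0n//.
by apply/negP => ?; apply: tX; rewrite inE.
Qed.

Lemma l2_sqnorm_restrict S c : (l2_sqnorm (restrict_coef S c) <= l2_sqnorm c)%E.
Proof.
apply: le_esum => t _; rewrite lee_fin /restrict_coef; case: ifP => // _.
by rewrite normc0 expr0n sqr_ge0.
Qed.

(** The sum [F] of a finitely supported series is only known in [L^2], so it
    agrees with the finite combination up to a function of norm 0; comparing
    norms up to the factor 2 avoids arguing almost everywhere. *)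
Lemma le_L2_sum_fin_supp c X F : (forall t, t \notin X -> c t = 0) ->
  L2_sum Omega phi c F ->
  (L2_sqnorm Omega F <= 2%:E * L2_sqnorm Omega (partial_comb phi c X))%E /\
  (L2_sqnorm Omega (partial_comb phi c X) <= 2%:E * L2_sqnorm Omega F)%E.
Proof.
move=> c0 [[F1 F2 _] cvgF]; have mF : measurable_complex Omega F by split.
set P := partial_comb phi c X.
have mP : measurable_complex Omega P by exact: measurable_partial_comb.
have FP0 : L2_sqnorm Omega (fun x => F x - P x) = 0%E.
  apply/eqP; rewrite eq_le L2_sqnorm_ge0 andbT; apply/lee_addgt0Pr => e e0.
  have [X0 hX0] := cvgF e e0.
  have := hX0 (X0 `|` X)%fset (fsubsetUl _ _).
  by rewrite (@partial_comb_supp c X)// ?fsubsetUr// add0e => /ltW.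
have mFP : measurable_complex Omega (fun x => F x - P x).
  exact: measurable_complexB.
split.
  have := L2_sqnormD_le mOmega mP mFP; rewrite FP0 adde0.
  by under eq_fun do rewrite addrC subrK.
have := L2_sqnormB_le mOmega mF mFP; rewrite FP0 adde0.
by under eq_fun do rewrite opprB addrC subrK.
Qed.

(** Setting some coefficients to 0 decreases the [l^2] norm, and the two Riesz
    inequalities transfer this to [L^2(Omega)] up to a constant: coordinate
    projections are bounded uniformly in the set [S] of kept coordinates. *)
Lemma riesz_basis_projection_bounded : riesz_basis Omega phi ->
  exists2 K : R, 0 < K & forall S c X,
    (L2_sqnorm Omega (partial_comb phi (restrict_coef S c) X) <=
     K%:E * L2_sqnorm Omega (partial_comb phi c X))%E.
Proof.
move=> [_ [A [B [A0 B0 hAB]]]].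
(* The ratio B / A of the Riesz bounds, times the two factors 2 lost in
   le_L2_sum_fin_supp. *)
exists (4 * B / A); first by rewrite divr_gt0// mulr_gt0.
move=> S c X.
pose c' := restrict_coef (fun t => t \in X) c.
have c'0 t : t \notin X -> c' t = 0 by rewrite /c' /restrict_coef => /negPf ->.
have Sc'0 t : t \notin X -> restrict_coef S c' t = 0.
  by move=> /c'0; rewrite /restrict_coef; case: ifP.
have E1 : partial_comb phi c X = partial_comb phi c' X.
  apply/funext => x; apply: eq_big_seq => t tX.
  by rewrite /c' /restrict_coef tX.
have E2 : partial_comb phi (restrict_coef S c) X =
    partial_comb phi (restrict_coef S c') X.
  apply/funext => x; apply: eq_big_seq => t tX.
  by rewrite /c' /restrict_coef tX.
rewrite {}E1 {}E2.
have [F [sumF /andP[lowF _]]] := hAB _ (l2_sqnorm_fin_supp c'0).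
have [G [sumG /andP[_ uppG]]] := hAB _ (l2_sqnorm_fin_supp Sc'0).
have [FP _] := le_L2_sum_fin_supp c'0 sumF.
have [_ PG] := le_L2_sum_fin_supp Sc'0 sumG.
apply: (le_trans PG).
have -> : ((4 * B / A)%:E = (2 * B / A)%:E * 2%:E :> \bar R)%E.
  by rewrite -EFinM; congr EFin; field; rewrite gt_eqF.
rewrite -muleA; apply: (@le_trans _ _ ((2 * B / A)%:E * L2_sqnorm Omega F)%E); last first.
  by apply: lee_wpmul2l => //; rewrite lee_fin divr_ge0 ?mulr_ge0// ltW.
apply: (@le_trans _ _ ((2 * B)%:E * l2_sqnorm c')%E).
  rewrite (EFinM 2 B) -muleA; apply: lee_wpmul2l => //.
  apply: (le_trans uppG); apply: lee_wpmul2l; first by rewrite lee_fin ltW.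
  exact: l2_sqnorm_restrict.
rewrite (EFinM (2 * B)) -muleA; apply: lee_wpmul2l.
  by rewrite lee_fin mulr_ge0// ltW.
have -> : (l2_sqnorm c' = (A^-1)%:E * (A%:E * l2_sqnorm c'))%E.
  by rewrite muleA -EFinM mulVf ?mul1e// gt_eqF.
by apply: lee_wpmul2l => //; rewrite lee_fin invr_ge0 ltW.
Qed.

End finite_combinations.

(** * Exponentials, lattices and fundamental domains *)

Section exponentials.
Variables (R : realType) (d : nat).
Implicit Types (a b x y : 'cV[R]_d) (M : 'M[R]_d).

Lemma dotpDl a b x : dotp (a + b) x = dotp a x + dotp b x.
Proof. by rewrite -big_split; apply: eq_bigr => i _; rewrite mxE mulrDl. Qed.

Lemma dotpDr a x y : dotp a (x + y) = dotp a x + dotp a y.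
Proof. by rewrite -big_split; apply: eq_bigr => i _; rewrite mxE mulrDr. Qed.

Lemma dotp0l x : dotp 0 x = 0.
Proof. by rewrite /dotp big1// => i _; rewrite mxE mul0r. Qed.

Lemma expoDl a b x : expo (a + b) x = expo a x * expo b x.
Proof. by rewrite /expo dotpDl mulrDr cosD sinD; simpc; congr (_ +i* _)%C; ring. Qed.

Lemma expoDr a x y : expo a (x + y) = expo a x * expo a y.
Proof. by rewrite /expo dotpDr mulrDr cosD sinD; simpc; congr (_ +i* _)%C; ring. Qed.

Lemma expo0l x : expo 0 x = 1.
Proof. by rewrite /expo dotp0l mulr0 cos0 sin0. Qed.

Lemma normc_expo a x : normc (expo a x) = 1.
Proof. by rewrite /expo /normc cos2Dsin2 sqrtr1. Qed.

Lemma cos_sin_2pi_int (m : int) :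
  cos (2 * pi * m%:~R) = 1 :> R /\ sin (2 * pi * m%:~R) = 0 :> R.
Proof.
have nat2pi (n : nat) : cos (2 * pi * n%:R) = 1 :> R /\ sin (2 * pi * n%:R) = 0 :> R.
  have -> : 2 * pi * n%:R = 0 + pi *+ 2 *+ n :> R by rewrite add0r mulr_natr mulr_natl.
  by rewrite (periodicn (@cosD2pi R)) (periodicn (@sinD2pi R)) cos0 sin0.
case: m => n; first exact: nat2pi.
by rewrite NegzE mulrNz mulrN cosN sinN; have [-> ->] := nat2pi n.+1; rewrite oppr0.
Qed.

Lemma expo_dual_lattice M h l : dual_lattice M h -> lattice M l -> expo h l = 1.
Proof.
move=> hh /hh /intrP[m hm]; rewrite /expo hm.
by have [-> ->] := cos_sin_2pi_int m.
Qed.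

Lemma normc_expoB a x y :
  normc (expo a (y - x) - 1) = normc (expo a x - expo a y).
Proof.
rewrite -[LHS]mul1r -(normc_expo a x) -normcM mulrBr -expoDr [x + _]addrC subrK mulr1.
by rewrite -normcN opprB.
Qed.

Lemma latticeB M l l' : lattice M l -> lattice M l' -> lattice M (l - l').
Proof.
move=> [z _ <-] [z' _ <-]; exists (z - z') => //.
by rewrite -mulmxBr; congr (_ *m _); apply/matrixP => i j; rewrite !mxE rmorphB.
Qed.

(** [M t] has its coordinates [t] bounded by half-open intervals, and these
    coordinates are linear forms, hence measurable. *)
Lemma measurable_fundamental_domain M : M \in unitmx ->
  measurable (fundamental_domain M : set (euclid R d)).
Proof.
move=> uM; pose g i (x : euclid R d) := (invmx M *m x) i 0.
have mg i : measurable_fun setT (g i).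
  have -> : g i = fun x : euclid R d => \sum_(j < d) invmx M i j * (x : 'cV[R]_d) j 0.
    by apply/funext => x; rewrite /g mxE.
  apply: measurable_sum => j.
  exact: (measurable_funM (measurable_cst (invmx M i j)) (measurable_coord j)).
have -> : fundamental_domain M = \bigcap_(i in [set: 'I_d]) (setT `&` g i @^-1` `[- 2^-1, 2^-1[).
  apply/seteqP; split => x.
    by move=> [t ht <-] i _; split => //; rewrite /g /= mulKmx// in_itv/=.
  move=> hx; exists (invmx M *m x); last by rewrite mulKVmx.
  by move=> i; have [//|_] := hx i; rewrite /g /= in_itv/=.
apply: fin_bigcap_measurable => // i _; exact: mg.
Qed.

Lemma lebesgue_fundamental_domain_lty M :
  (lebesgue R d (fundamental_domain M) < +oo)%E.
Proof.
(* The box p below is half-open: the 1 keeps the points off its open faces. *)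
pose r : R := 1 + \sum_i \sum_j `|M i j|.
pose p : 'cV[R]_d * 'cV[R]_d := (const_mx (- r), const_mx r).
apply: (@le_lt_trans _ _ (lebesgue R d (box p))).
  apply: le_outer_measure => _ [t ht <-] i; rewrite !mxE.
  suff : `|\sum_j M i j * t j 0| < r by rewrite ltr_norml => /andP[/ltW -> ->].
  apply: (@le_lt_trans _ _ (\sum_j `|M i j|)).
    apply: (le_trans (ler_norm_sum _ _ _)); apply: ler_sum => j _.
    rewrite normrM ler_piMr// ler_norml; have /andP[? ?] := ht j; lra.
  rewrite /r ltr_pwDl// [leRHS](bigD1 i)//= lerDl sumr_ge0// => *.
  by apply: sumr_ge0.
exact: le_lt_trans (lebesgue_box p) (ltry _).
Qed.

(** The coordinates of two points of the fundamental domain differ by less than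
    1, so an integral difference vanishes. *)
Lemma fundamental_domain_lattice_inj M x l : M \in unitmx ->
  fundamental_domain M x -> lattice M l -> fundamental_domain M (x + l) -> l = 0.
Proof.
move=> uM [t ht <-] [z _ <-] [s hs]; rewrite -mulmxDr => /(can_inj (mulKmx uM)) ts.
suff -> : z = 0 by rewrite map_mx0 mulmx0.
apply/matrixP => i j; rewrite ord1 [in RHS]mxE.
have := congr1 (fun y : 'cV[R]_d => y i 0) ts; rewrite !mxE => tsi.
have /andP[? ?] := ht i; have /andP[? ?] := hs i.
have : (-1)%:~R < (z i 0)%:~R :> R by rewrite rmorphN1; lra.
have : (z i 0)%:~R < 1%:~R :> R by rewrite rmorph1; lra.
by rewrite !ltr_int; lia.
Qed.

End exponentials.

(** * Overlaps with nearly equal exponentials are null *)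

Section null_overlap.
Variables (R : realType) (d : nat) (M : 'M[R]_d) (Omega : set 'cV[R]_d).
Hypothesis mOmega : measurable (Omega : set (euclid R d)).
Variable a : 'I_2 -> 'cV[R]_d.
Let phi (p : 'I_2 * dual_lattice M) := expo (a p.1 + val p.2).
Let P0 c X := partial_comb phi (restrict_coef (fun p => p.1 == 0) c) X.

(** Translation by [l] multiplies each term of the combination by
    [expo (a 0) l] or [expo (a 1) l], as [expo h l = 1] for dual lattice vectors [h]; the chosen
    factor cancels the terms with index 1. *)
Lemma partial_comb_shift c X l x : lattice M l ->
  partial_comb phi c X x - expo (- a 1) l * partial_comb phi c X (x + l) =
  (1 - expo (a 0 - a 1) l) * P0 c X x.
Proof.
move=> Ml; rewrite /P0 /partial_comb !mulr_sumr -sumrB.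
apply: eq_bigr => -[j h] _; rewrite /phi /restrict_coef /= expoDr.
have -> : expo (a j + \val h) l = expo (a j) l.
  by rewrite expoDl (@expo_dual_lattice _ _ M (\val h))// ?mulr1//; exact: set_valP.
rewrite (expoDl (a 0)); set u := expo (a j + \val h) x; set e := expo (- a 1) l.
have [->|j0] := eqVneq j 0; first by ring.
have -> : j = 1 by apply/val_inj; case: j j0 {u} => -[|[|]].
have : e * expo (a 1) l = 1 by rewrite /e -expoDl addNr expo0l.
by move=> e1; rewrite mul0r mulr0 [_ * u]mulrC mulrCA (mulrCA e) e1; ring.
Qed.

(** An approximation [P] of the indicator function of [E] has
    [P x - expo (- a 1) l * P (x + l)] close to 1 on [E], but this difference is
    [1 - expo (a 0 - a 1) l] times a function of comparable norm.  The bound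
    [delta] depends on the constant of [riesz_basis_projection_bounded] only, so
    it serves all [E] and [l]. *)
Lemma null_overlap : riesz_basis Omega phi ->
  exists2 delta : R, 0 < delta & forall (E : set 'cV[R]_d) l,
    measurable (E : set (euclid R d)) -> (lebesgue R d E < +oo)%E ->
    lattice M l -> E `<=` Omega -> (forall x, E x -> Omega (x + l)) ->
    (forall x, E x -> ~ E (x + l)) ->
    normc (expo (a 0 - a 1) l - 1) < delta ->
    lebesgue R d E = 0%E.
Proof.
move=> rb; have mphi p D : measurable_complex D (phi p) by exact: measurable_expo.
have [K K0 hK] := riesz_basis_projection_bounded mOmega (fun p => mphi p _) rb.
have [cpl _] := rb.
(* With this value the term of the final estimate that contains delta equals
   (m + eps) / 2, which the left hand side m absorbs. *)
pose delta : R := Num.sqrt (16 * K)^-1.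
have K16 : 0 < (16 * K)^-1 by rewrite invr_gt0 mulr_gt0.
exists delta; first by rewrite sqrtr_gt0.
have delta2 : delta ^+ 2 * K = 16^-1.
  by rewrite /delta sqr_sqrtr ?ltW//; field; rewrite gt_eqF.
move=> E l mE finE Ml EO ElO Edisj small.
pose f (x : 'cV[R]_d) : R[i] := (\1_E x : R)%:C%C.
have mf D : measurable_complex D f.
  by split => /=; [exact: measurable_indic|exact: measurable_cst].
have normf x : normc (f x) ^+ 2 = \1_E x.
  rewrite sqr_normc_ReIm /= expr0n addr0 indicE.
  by case: (x \in E); rewrite ?expr1n ?expr0n.
have L2f D : measurable (D : set (euclid R d)) -> E `<=` D ->
    L2_sqnorm D f = lebesgue R d E.
  move=> mD ED; rewrite /L2_sqnorm; under eq_integral do rewrite normf.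
  by rewrite integral_indic// setIidl.
have fin : lebesgue R d E \is a fin_num by rewrite ge0_fin_numE.
set m := fine (lebesgue R d E).
have mfE : lebesgue R d E = m%:E by rewrite fineK.
(* 13 comes from solving m <= 6 * eps + (m + eps) / 2 for m. *)
suff key eps : 0 < eps -> m <= 13 * eps.
  have m0 : 0 <= m by rewrite fine_ge0.
  rewrite mfE; congr EFin; apply/eqP; rewrite eq_le m0 andbT.
  apply/ler_addgt0Pr => e e0; rewrite add0r.
  by apply: le_trans (key (e / 13) _) _; [rewrite divr_gt0|lra].
move=> eps0.
have [|c [X approx]] := cpl f _ eps eps0.
  by have [f1 f2] := mf Omega; split => //; rewrite L2f// mfE ltry.
set P := partial_comb phi c X in approx.
pose res x := f x - P x.
have mP D : measurable_complex D P by apply: measurable_partial_comb.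
have mP0 D : measurable_complex D (P0 c X) by apply: measurable_partial_comb.
have mres D : measurable_complex D res := measurable_complexB (mf D) (mP D).
have resE : (L2_sqnorm E res <= eps%:E)%E.
  exact: le_trans (L2_sqnorm_subset mOmega mE EO (mres _)) (ltW approx).
have mEl : measurable ((fun x => x - l) @^-1` E : set (euclid R d)).
  exact: measurable_shift.
have resEl : (L2_sqnorm E (fun x => res (x + l)%R) <= eps%:E)%E.
  rewrite (L2_sqnorm_shift _ mE (mres _)).
  apply: le_trans (L2_sqnorm_subset mOmega mEl _ (mres _)) (ltW approx).
  by move=> x /= /ElO; rewrite subrK.
have mresl : measurable_complex E (fun x => res (x + l)).
  exact: measurable_complex_shift.
have P0E : (L2_sqnorm E (P0 c X) <= (K * (2 * (m + eps)))%:E)%E.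
  apply: le_trans (L2_sqnorm_subset mOmega mE EO (mP0 _)) _.
  apply: le_trans (hK _ _ _) _; rewrite EFinM; apply: lee_wpmul2l.
    by rewrite lee_fin ltW.
  have -> : partial_comb phi c X = fun x => f x - res x.
    by apply/funext => x; rewrite /res opprB addrC subrK.
  apply: le_trans (L2_sqnormB_le mOmega (mf _) (mres _)) _.
  rewrite EFinM; apply: lee_wpmul2l => //.
  by rewrite EFinD L2f// mfE; apply: leeD => //; exact: ltW.
set u := - expo (- a 1) l; set v := 1 - expo (a 0 - a 1) l.
have fE x : x \in E -> f x = res x + (u * res (x + l) + v * P0 c X x).
  rewrite inE => Ex.
  have fx : f x = 1 by rewrite /f indicE mem_set.
  (* E and its translate are disjoint, so f does not see x + l. *)
  have fxl : f (x + l) = 0 by rewrite /f indicE memNset//; exact: Edisj.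
  by rewrite /v -partial_comb_shift// /res fx fxl -/P /u; ring.
have normu : normc u ^+ 2 = 1 by rewrite normcN normc_expo expr1n.
have normv : normc v ^+ 2 <= delta ^+ 2.
  have vd : normc v <= delta by rewrite -normcN opprB ltW.
  by rewrite !expr2 ler_pM ?normc_ge0.
have tailE : (L2_sqnorm E (fun x => (u * res (x + l) + v * P0 c X x)%R) <=
    (2 * (eps + delta ^+ 2 * (K * (2 * (m + eps)))))%:E)%E.
  have mv := measurable_complexZ v (mP0 E).
  apply: le_trans (L2_sqnormD_le mE (measurable_complexZ u mresl) mv) _.
  rewrite !L2_sqnormZ// normu mul1e (EFinM 2); apply: lee_wpmul2l => //.
  rewrite (EFinD eps); apply: leeD => //; rewrite (EFinM (delta ^+ 2)).
  by apply: lee_pmul => //; rewrite ?lee_fin ?sqr_ge0// L2_sqnorm_ge0.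
have bound : (m%:E <=
    (2 * (eps + 2 * (eps + delta ^+ 2 * (K * (2 * (m + eps))))))%:E)%E.
  rewrite -mfE -(L2f E)//.
  have -> : L2_sqnorm E f =
      L2_sqnorm E (fun x => res x + (u * res (x + l) + v * P0 c X x)).
    by apply: eq_integral => x Ex; rewrite fE.
  have mtail := measurable_complexD (measurable_complexZ u mresl)
    (measurable_complexZ v (mP0 E)).
  apply: le_trans (L2_sqnormD_le mE (mres _) mtail) _.
  rewrite (EFinM 2); apply: lee_wpmul2l => //.
  by rewrite (EFinD eps); apply: leeD.
by move: bound; rewrite lee_fin [delta ^+ 2 * _]mulrA delta2; lra.
Qed.

End null_overlap.

(** * The separated subset *)

(** Sorting permutes the duplicate-free enumeration of the fibre, so the list
    has exactly [k] entries and the default value of [nth] never shows up. *)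
Lemma lambda_vec_fibre (R : realType) (d k : nat) (M : 'M[R]_d) (Omega : set 'cV[R]_d) w :
  (lattice_fibre M Omega w #= [set: 'I_k])%card ->
  (forall j, lattice_fibre M Omega w (lambda_vec k M Omega w j)) /\
  injective (lambda_vec k M Omega w).
Proof.
move=> cardA; set A := lattice_fibre M Omega w in cardA *.
have cardk : (A #= `I_k)%card by apply: (card_eq_trans cardA); rewrite card_eq_sym card_II.
have finA : finite_set A by apply/finite_setP; exists k.
have sz : size (sort (@lexle R d) (fset_set A)) = k.
  by rewrite size_sort (card_fset_set cardk).
split => [j|i j /eqP].
  have : lambda_vec k M Omega w j \in sort (@lexle R d) (fset_set A).
    by apply: mem_nth; rewrite sz.
  by rewrite mem_sort in_fset_set// inE.
by rewrite nth_uniq ?sz ?sort_uniq ?fset_uniq// => /eqP/val_inj.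
Qed.

Lemma measure_bigcup_countable0 d (T : measurableType d) (R : realType)
    (mu : {measure set T -> \bar R}) (I : countType) (F : I -> set T) :
  (forall i, measurable (F i)) -> (forall i, mu (F i) = 0%E) ->
  mu (\bigcup_i F i) = 0%E.
Proof.
move=> mF F0.
pose G n := if choice.unpickle n is Some i then F i else set0.
have mG n : measurable (G n) by rewrite /G; case: choice.unpickle.
have FG : \bigcup_i F i = \bigcup_n G n.
  apply/seteqP; split => x [n _ Fnx].
    by exists (choice.pickle n) => //; rewrite /G choice.pickleK.
  by move: Fnx; rewrite /G; case: choice.unpickle => // i Fix; exists i.
have : mu.-negligible (\bigcup_n G n).
  apply: negligible_bigcup => n; apply/negligibleP => //.
  by rewrite /G; case: choice.unpickle => //; rewrite measure0.
by rewrite FG negligibleP//; exact: bigcupT_measurable.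
Qed.

Section overlaps.
Variables (R : realType) (d : nat) (M : 'M[R]_d) (Omega : set 'cV[R]_d).

Definition overlap (l l' : 'cV[R]_d) : set 'cV[R]_d :=
  [set w | [/\ fundamental_domain M w, Omega (l + w) & Omega (l' + w)]].

Hypothesis uM : M \in unitmx.
Hypothesis mOmega : measurable (Omega : set (euclid R d)).

Lemma measurable_overlap l l' : measurable (overlap l l' : set (euclid R d)).
Proof.
have -> : overlap l l' = fundamental_domain M `&`
    ((fun w => w + l) @^-1` Omega `&` (fun w => w + l') @^-1` Omega).
  by apply/seteqP; split => w /=; rewrite ![w + _]addrC;
    [case=> ? ? ?|case=> ? []].
apply: measurableI; first exact: measurable_fundamental_domain.
by apply: measurableI; exact: measurable_shift.
Qed.

(** [overlap l l' + l] and its translate by [l' - l] are disjoint subsets of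
    [Omega], to which [null_overlap] applies. *)
Lemma overlap_null : structured_riesz_basis 2 M Omega ->
  exists (alpha : 'cV[R]_d) (delta : R), 0 < delta /\ forall l l',
    lattice M l -> lattice M l' -> l != l' ->
    normc (expo alpha l - expo alpha l') < delta ->
    lebesgue R d (overlap l l') = 0%E.
Proof.
move=> [a rb]; have [delta d0 H] := null_overlap mOmega rb.
exists (a 0 - a 1), delta; split => // l l' Ml Ml' ll' small.
rewrite -(lebesgue_shift (- l)).
apply: (H _ (l' - l)).
- exact: measurable_shift (measurable_overlap _ _).
- rewrite lebesgue_shift; apply: le_lt_trans (lebesgue_fundamental_domain_lty M).
  by apply: le_outer_measure => w [].
- exact: latticeB.
- by move=> x [_ + _]; rewrite addrC subrK.
- by move=> x [_ _]; rewrite addrCA addrC -addrA [- l + _]addrC.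
- move=> x [Ix _ _] [Ix' _ _]; move/eqP: ll'; apply.
  apply/esym/subr0_eq; apply: (fundamental_domain_lattice_inj uM Ix).
    exact: latticeB.
  by move: Ix'; rewrite addrAC.
- by rewrite normc_expoB.
Qed.

End overlaps.

Theorem theorem4p7 (R : realType) (d : nat) (M : 'M[R]_d)
    (Omega : set 'cV[R]_d)
    (hM : M \in unitmx)
    (mOmega : measurable (Omega : set (euclid R d)))
    (htile : k_tiles 2 M Omega)
    (hfibre : forall w : 'cV[R]_d, fundamental_domain M w ->
      (lattice_fibre M Omega w #= [set: 'I_2])%card)
    (hriesz : structured_riesz_basis 2 M Omega) :
  exists (J : set 'cV[R]_d) (alpha : 'cV[R]_d) (delta : R),
    [/\ full_measure_subset J (fundamental_domain M),
        0 < delta &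
        exp_separated alpha delta (Lambda_set 2 M Omega J)].
Proof.
have [alpha [delta [d0 null]]] := overlap_null hM mOmega hriesz.
(* Lattice points are indexed by integer vectors, which form a countable type. *)
pose L (z : 'cV[int]_d) : 'cV[R]_d := M *m map_mx (fun n : int => n%:~R) z.
have ML z : lattice M (L z) by exists z.
pose bad (z : 'cV[int]_d * 'cV[int]_d) : bool := (L z.1 != L z.2) &&
  (normc (expo alpha (L z.1) - expo alpha (L z.2)) < delta).
pose B z := if bad z then overlap M Omega (L z.1) (L z.2) else set0.
have mB z : measurable (B z : set (euclid R d)).
  rewrite /B; case: ifP => _; last exact: measurable0.
  exact: measurable_overlap.
have nullB z : lebesgue R d (B z) = 0%E.
  by rewrite /B; case: ifP => [/andP[? ?]|_]; [exact: null|exact: measure0].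
have mI := measurable_fundamental_domain hM.
have mU : measurable (\bigcup_z B z : set (euclid R d)).
  exact: countable_bigcupT_measurable.
exists (fundamental_domain M `\` \bigcup_z B z), alpha, delta; split => //.
- split => [w []//||]; first exact: measurableD.
  rewrite setDD; apply/eqP; rewrite -measure_le0.
  rewrite -(measure_bigcup_countable0 mB nullB).
  by apply: le_measure; rewrite ?inE//; exact: measurableI.
- move=> _ [w [Iw nBw] <-] i j ij.
  have [fib inj] := lambda_vec_fibre (hfibre w Iw).
  rewrite leNgt; apply/negP => small; apply: nBw.
  have [[z _ zi] Oi] := fib i; have [[z' _ zj] Oj] := fib j.
  exists (z, z') => //; rewrite /B /bad /L /= zi zj.
  by rewrite small (inj_eq inj) ij.
Qed.
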